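(* Let $t_0\ge 0$, $M\in\mathbb{R}$, and let $\alpha,\beta:[t_0,+\infty)\to\mathbb{R}$ be continuous functions, absolutely integrable over $[t_0,+\infty)$, with $\alpha(t)\le\beta(t)$ for all $t\ge t_0$ and $\lim_{t\to+\infty}\alpha(t)=\lim_{t\to+\infty}\beta(t)=0$. Define $$C_M=\left\{u\in C([t_0,+\infty),\mathbb{R}): M-\int_t^{+\infty}\beta(s)\,ds\le u(t)\le M-\int_t^{+\infty}\alpha(s)\,ds\ \text{ for all } t\ge t_0\right\}$$ and $$D=\{v\in C([t_0,+\infty),\mathbb{R}):\alpha(t)\le v(t)\le\beta(t)\ \text{ for all } t\ge t_0\}.$$ Let $f:[t_0,+\infty)\times\mathbb{R}^2\to\mathbb{R}$ be a continuous function such that $$\alpha(t)\le\int_t^{+\infty}f(s,u(s),v(s))\,ds\le\beta(t),\qquad t\ge t_0,$$ for all $u\in C_M$ and $v\in D$. Assume moreover that $$|f(t,u_2(t),v_2(t))-f(t,u_1(t),v_1(t))|\le k_1(t)|u_2(t)-u_1(t)|+k_2(t)|v_2(t)-v_1(t)|$$ for all $u_1,u_2\in C_M$, $v_1,v_2\in D$ and $t\ge t_0$, where $k_1,k_2:[t_0,+\infty)\to[0,+\infty)$ are continuous and there exists a number $\zeta>0$ such that $$\chi=\zeta\int_{t_0}^{+\infty}k_1(t)\,dt+\int_{t_0}^{+\infty}(t-t_0)k_1(t)\,dt+\int_{t_0}^{+\infty}k_2(t)\,dt+\frac1\zeta\int_{t_0}^{+\infty}(t-t_0)k_2(t)\,dt<1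 .$$ Then the boundary value problem $$\begin{cases}x''+f(t,x,x')=0,\qquad t\ge t_0,\\ \lim\limits_{t\to+\infty}x(t)=M,\\ \alpha(t)\le x'(t)\le\beta(t),\qquad t\ge t_0,\end{cases}$$ has a unique solution.
   Context: A solution is a twice continuously differentiable function on $[t_0,+\infty)$ satisfying all the listed conditions. The integrals $\int_t^{+\infty} f(s,u(s),v(s))\,ds$ are assumed to be convergent, as part of the double inequality hypothesis. *)

(* Defs.v *)
From Stdlib Require Import Reals.
From Coquelicot Require Import Coquelicot.
Open Scope R_scope.

(** Functions on [[t0, +oo)] are total functions on [R] constrained only on this
    half-line: continuity and derivatives are taken within it (hence one-sided
    at [t0]), and values to the left of [t0] play no role. *)
Definition halfline (t0 : R) : R -> Prop := fun t => t0 <= t.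

Definition ex_int_from (g : R -> R) (t : R) : Prop :=
  ex_RInt_gen g (at_point t) (Rbar_locally p_infty).

(** Improper Riemann integral over [[t, +oo)]; meaningful under [ex_int_from]. *)
Definition int_from (g : R -> R) (t : R) : R :=
  RInt_gen g (at_point t) (Rbar_locally p_infty).

Definition abs_integrable (t0 : R) (g : R -> R) : Prop :=
  ex_int_from (fun s => Rabs (g s)) t0.

Definition in_C (t0 M : R) (alpha beta u : R -> R) : Prop :=
  continuous_on (halfline t0) u /\
  forall t, t0 <= t ->
    M - int_from beta t <= u t <= M - int_from alpha t.

Definition in_D (t0 : R) (alpha beta v : R -> R) : Prop :=
  continuous_on (halfline t0) v /\
  forall t, t0 <= t -> alpha t <= v t <= beta t.

Definition continuous_nonlinearity (t0 : R) (f : R -> R -> R -> R) : Prop :=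
  continuous_on (fun p : R * R * R => t0 <= fst (fst p))
                (fun p : R * R * R => f (fst (fst p)) (snd (fst p)) (snd p)).

Definition chi (t0 : R) (k1 k2 : R -> R) (zeta : R) : R :=
  zeta * int_from k1 t0 + int_from (fun t => (t - t0) * k1 t) t0
  + int_from k2 t0 + / zeta * int_from (fun t => (t - t0) * k2 t) t0.

(** [x] is twice continuously differentiable on [[t0, +oo)], with first and
    second derivatives [dx] and [ddx] there. *)
Definition C2_with_derivatives (t0 : R) (x dx ddx : R -> R) : Prop :=
  (forall t, t0 <= t -> D_in x dx (halfline t0) t) /\
  (forall t, t0 <= t -> D_in dx ddx (halfline t0) t) /\
  continuous_on (halfline t0) ddx.

Definition is_solution (t0 M : R) (alpha beta : R -> R) (f : R -> R -> R -> R)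
    (x : R -> R) : Prop :=
  exists dx ddx : R -> R,
    C2_with_derivatives t0 x dx ddx /\
    (forall t, t0 <= t -> ddx t + f t (x t) (dx t) = 0) /\
    is_lim x p_infty M /\
    (forall t, t0 <= t -> alpha t <= dx t <= beta t).

(* Main.v *)
Require Import Defs.
From Stdlib Require Import Reals Lra.
From Coquelicot Require Import Coquelicot.
Open Scope R_scope.

(** The boundary value problem is a fixed point problem for pairs (u, v), to be
    read as (x, x'). Since alpha <= x' <= beta forces x' to vanish at infinity,
    integrating the equation and the condition x(+oo) = M from infinity shows
    that the solutions are the fixed points, among pairs in C_M x D, of
    [picard]: (u, v) |-> (M - int_t^oo w, w) with w(t) = int_t^oo f(s, u, v) ds
    ([solution_fixed_point], [fixed_point_solution]). The bounds assumed on the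
    integrals of f say that w stays in D, and integrating alpha <= w <= beta
    once more puts the first component in C_M.

    The operator contracts, with ratio chi, the distance
    max (sup |u1 - u2|, zeta sup |v1 - v2|) ([picard_contraction]). If this
    distance is at most d, the Lipschitz condition bounds the difference of the
    two integrands by g = d k1 + (d / zeta) k2; hence the difference of the second
    components by int_t0^oo g and, after a second integration, that of the first
    components by int_t0^oo int_t^oo g = int_t0^oo (s - t0) g(s) ds
    ([int_from_int_from]). Multiplied by zeta, the former yields the first and
    third terms of chi d; the latter yields the second and fourth.

    Picard iteration then gives existence ([contraction_fixed_point]). Any two
    admissible pairs are at finite distance because alpha and beta, and the two
    functions bounding C_M, have finite limits at infinity ([admissible_close]);
    so iterating the contraction also gives uniqueness ([contraction_unique]). *)

(** * Improper integrals of functions continuous on a half-line *)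

(** Freezing g at its value at t0 to the left of t0 makes it continuous
    everywhere, so that theorems about two-sided continuity and derivatives
    apply to functions controlled only within the half-line. *)
Lemma continuous_extend (t0 : R) (g : R -> R) :
  continuous_on (halfline t0) g ->
  forall t, continuous (fun s => g (Rmax t0 s)) t.
Proof.
  intros hg t.
  assert (ht : halfline t0 (Rmax t0 t)) by apply Rmax_l.
  apply (filterlim_comp _ _ _ (Rmax t0) g _ (within (halfline t0) (locally (Rmax t0 t)))).
  (* [Rmax t0] is nonexpansive *)
  - intros P [eps hP]. exists eps. intros s hs. apply hP; [|apply Rmax_l].
    apply Rle_lt_trans with (2 := hs). unfold abs, minus, plus, opp; simpl.
    unfold Rmax; destruct (Rle_dec t0 s), (Rle_dec t0 t); unfold Rabs;
      repeat destruct Rcase_abs; lra.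
  - exact (hg _ ht).
Qed.

Lemma ex_RInt_halfline (t0 a b : R) (g : R -> R) :
  continuous_on (halfline t0) g -> t0 <= a -> t0 <= b -> ex_RInt g a b.
Proof.
  intros hg ha hb.
  apply ex_RInt_ext with (fun s => g (Rmax t0 s)).
  - intros s [hs _]. rewrite Rmax_right; [reflexivity|].
    apply Rlt_le, Rle_lt_trans with (2 := hs). now apply Rmin_glb.
  - apply (ex_RInt_continuous (V := R_CompleteNormedModule)). intros s _. now apply continuous_extend.
Qed.

Lemma continuous_on_halfline_le (a b : R) (g : R -> R) :
  a <= b -> continuous_on (halfline a) g -> continuous_on (halfline b) g.
Proof.
  intros hab. apply continuous_on_subset. unfold halfline. intros x hx. lra.
Qed.

Lemma int_from_correct (t : R) (g : R -> R) :
  ex_int_from g t ->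
  is_RInt_gen g (at_point t) (Rbar_locally p_infty) (int_from g t).
Proof.
  intros hex. exact (RInt_gen_correct (V := R_CompleteNormedModule) g hex).
Qed.

Lemma int_from_unique (t l : R) (g : R -> R) :
  is_RInt_gen g (at_point t) (Rbar_locally p_infty) l -> int_from g t = l.
Proof.
  intros h. exact (is_RInt_gen_unique (V := R_CompleteNormedModule) g l h).
Qed.

(** Together with [is_lim_int_from], this trades the filter-based improper
    integral for an ordinary limit of proper integrals. *)
Lemma int_from_is_lim (t : R) (g : R -> R) :
  continuous_on (halfline t) g -> ex_int_from g t ->
  is_lim (fun T => RInt g t T) p_infty (int_from g t).
Proof.
  intros hg hex.
  assert (h := int_from_correct t g hex).
  intros P hP. destruct (h P hP) as [Q S hQ [N hS] hQS].
  exists (Rmax N t). intros T hT.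
  assert (hN := Rmax_l N t). assert (ht := Rmax_r N t).
  destruct (hQS t T hQ (hS T ltac:(lra))) as [l [hl hPl]].
  simpl in hl. now rewrite (is_RInt_unique (V := R_CompleteNormedModule) _ _ _ _ hl).
Qed.

Lemma is_lim_int_from (t l : R) (g : R -> R) :
  continuous_on (halfline t) g ->
  is_lim (fun T => RInt g t T) p_infty l ->
  ex_int_from g t /\ int_from g t = l.
Proof.
  intros hg hlim.
  assert (h : is_RInt_gen g (at_point t) (Rbar_locally p_infty) l).
  { intros P hP. destruct (hlim P hP) as [N hN].
    apply (Filter_prod _ _ _ (fun s => s = t) (fun T => N < T /\ t < T)).
    - reflexivity.
    - exists (Rmax N t). intros T hT.
      assert (hN' := Rmax_l N t). assert (ht := Rmax_r N t). lra.
    - intros s T -> [hT1 hT2]. simpl. exists (RInt g t T). split.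
      + apply (RInt_correct (V := R_CompleteNormedModule)), ex_RInt_halfline with t; try assumption; lra.
      + now apply hN. }
  split; [now exists l|].
  now apply int_from_unique.
Qed.

Lemma int_from_Chasles (a b : R) (g : R -> R) :
  continuous_on (halfline a) g -> ex_int_from g a -> a <= b ->
  ex_int_from g b /\ int_from g a = RInt g a b + int_from g b.
Proof.
  intros hg hex hab.
  destruct (is_lim_int_from b (int_from g a - RInt g a b) g) as [h1 h2].
  - now apply continuous_on_halfline_le with a.
  - apply is_lim_ext_loc with (fun T => RInt g a T - RInt g a b).
    + exists b. intros T hT.
      rewrite <- (RInt_Chasles (V := R_CompleteNormedModule) g a b T).
      * unfold plus; simpl; ring.
      * apply ex_RInt_halfline with a; auto; lra.
      * apply ex_RInt_halfline with a; auto; lra.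
    + apply is_lim_minus'.
      * now apply int_from_is_lim.
      * apply is_lim_const.
  - split; [assumption|]. rewrite h2. ring.
Qed.

Lemma is_lim_int_from_0 (t0 : R) (g : R -> R) :
  continuous_on (halfline t0) g -> ex_int_from g t0 ->
  is_lim (int_from g) p_infty 0.
Proof.
  intros hg hex.
  apply is_lim_ext_loc with (fun T => int_from g t0 - RInt g t0 T).
  - exists t0. intros T hT.
    destruct (int_from_Chasles t0 T g hg hex ltac:(lra)) as [_ ->]. ring.
  - replace (Finite 0) with (Finite (int_from g t0 - int_from g t0)) by (f_equal; ring).
    apply is_lim_minus'; [apply is_lim_const|now apply int_from_is_lim].
Qed.

Lemma is_derive_D_in (D : R -> Prop) (f df : R -> R) (t : R) :
  is_derive f t (df t) -> D_in f df D t.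
Proof.
  intros h. apply is_derive_Reals in h.
  intros eps heps. destruct (h eps heps) as [d hd].
  exists d. split; [apply cond_pos|].
  intros x [[_ hne] hx]. simpl in *. unfold Rdist in *.
  specialize (hd (x - t) ltac:(lra) hx).
  now replace (t + (x - t)) with x in hd by ring.
Qed.

Lemma D_in_is_derive (t0 t : R) (f df : R -> R) :
  t0 < t -> D_in f df (halfline t0) t -> is_derive f t (df t).
Proof.
  intros ht h. apply is_derive_Reals. intros eps heps.
  destruct (h eps heps) as [d [hd hlim]].
  assert (hm : 0 < Rmin d (t - t0)) by (apply Rmin_glb_lt; lra).
  exists (mkposreal _ hm). intros k hk hkd. simpl in *.
  assert (h1 := Rmin_l d (t - t0)). assert (h2 := Rmin_r d (t - t0)).
  unfold Rdist in hlim.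
  replace k with (t + k - t) at 2 by ring.
  apply hlim. unfold D_x, halfline.
  replace (t + k - t) with k by ring.
  repeat split; try lra.
  unfold Rabs in hkd; destruct Rcase_abs in hkd; lra.
Qed.

Lemma D_in_ext (t0 t : R) (f g df dg : R -> R) :
  t0 <= t -> (forall s, t0 <= s -> f s = g s) -> df t = dg t ->
  D_in f df (halfline t0) t -> D_in g dg (halfline t0) t.
Proof.
  intros ht hfg hd h eps heps. destruct (h eps heps) as [d [hd0 hlim]].
  exists d. split; [assumption|]. intros x [[hx hne] hxt].
  rewrite <- hd, <- !hfg by assumption. apply hlim. now repeat split.
Qed.

Lemma D_in_continuous_on (t0 : R) (f df : R -> R) :
  (forall t, t0 <= t -> D_in f df (halfline t0) t) ->
  continuous_on (halfline t0) f.
Proof.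
  intros h t ht P [eps hP].
  destruct (cont_deriv _ _ _ _ (h t ht) eps (cond_pos eps)) as [d [hd hlim]].
  exists (mkposreal d hd). intros s hs hst. apply hP.
  destruct (Req_dec s t) as [->|hne]; [apply ball_center|].
  apply hlim. repeat split; auto.
Qed.

(** The tail integral is a constant minus the primitive of the continuous
    extension of g, which is differentiable on the whole line; restricting to
    the half-line gives the one-sided derivative at t0 as well. *)
Lemma D_in_int_from (t0 t : R) (g : R -> R) :
  continuous_on (halfline t0) g -> ex_int_from g t0 -> t0 <= t ->
  D_in (int_from g) (fun s => - g s) (halfline t0) t.
Proof.
  intros hg hex ht.
  set (G := fun s => g (Rmax t0 s)).
  apply D_in_ext with (fun s => int_from g t0 - RInt G t0 s) (fun s => - G s).
  - assumption.
  - intros s hs. destruct (int_from_Chasles t0 s g hg hex hs) as [_ ->].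
    rewrite (RInt_ext G g); [ring|].
    intros r [hr _]. unfold G. rewrite Rmax_right; [reflexivity|].
    rewrite Rmin_left in hr; lra.
  - unfold G. now rewrite Rmax_right.
  - apply is_derive_D_in.
    replace (- G t) with (0 - G t) by ring.
    apply (is_derive_minus (V := R_NormedModule) (fun _ => int_from g t0));
      [exact (is_derive_const (V := R_NormedModule) _ t)|].
    apply is_derive_RInt with t0.
    + apply filter_forall. intros b.
      apply (RInt_correct (V := R_CompleteNormedModule)),
        (ex_RInt_continuous (V := R_CompleteNormedModule)).
      intros; now apply continuous_extend.
    + now apply continuous_extend.
Qed.

Lemma continuous_on_int_from (t0 : R) (g : R -> R) :
  continuous_on (halfline t0) g -> ex_int_from g t0 ->
  continuous_on (halfline t0) (int_from g).
Proof.
  intros hg hex. apply D_in_continuous_on with (fun s => - g s).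
  intros t ht. now apply D_in_int_from.
Qed.

Lemma Rabs_int_from_le (t : R) (g h : R -> R) :
  ex_int_from g t -> ex_int_from h t ->
  (forall s, t <= s -> Rabs (g s) <= h s) ->
  Rabs (int_from g t) <= int_from h t.
Proof.
  intros hg hh hle.
  apply (RInt_gen_norm (V := R_CompleteNormedModule)
           (Fa := at_point t) (Fb := Rbar_locally p_infty) g h).
  - apply (Filter_prod _ _ _ (fun s => s = t) (fun T => t < T)); [reflexivity| now exists t|].
    intros s T -> hT. simpl. lra.
  - apply (Filter_prod _ _ _ (fun s => s = t) (fun T => t < T)); [reflexivity| now exists t|].
    intros s T -> hT x [hx _]. now apply hle.
  - now apply int_from_correct.
  - now apply int_from_correct.
Qed.

Lemma int_from_nonneg (t : R) (g : R -> R) :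
  ex_int_from g t -> (forall s, t <= s -> 0 <= g s) -> 0 <= int_from g t.
Proof.
  intros hex hpos.
  apply Rle_trans with (1 := Rabs_pos (int_from g t)).
  apply Rabs_int_from_le; auto. intros s hs. rewrite Rabs_pos_eq; auto with real.
Qed.

Lemma int_from_scal (t a : R) (g : R -> R) :
  ex_int_from g t ->
  ex_int_from (fun s => a * g s) t /\ int_from (fun s => a * g s) t = a * int_from g t.
Proof.
  intros hg.
  assert (H := is_RInt_gen_scal (V := R_NormedModule) g a _ (int_from_correct t g hg)).
  split; [eexists; exact H|]. now apply int_from_unique.
Qed.

Lemma int_from_lin (t a b : R) (g h : R -> R) :
  ex_int_from g t -> ex_int_from h t ->
  ex_int_from (fun s => a * g s + b * h s) t /\
  int_from (fun s => a * g s + b * h s) t = a * int_from g t + b * int_from h t.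
Proof.
  intros hg hh.
  assert (H : is_RInt_gen (fun s => a * g s + b * h s) (at_point t)
            (Rbar_locally p_infty) (a * int_from g t + b * int_from h t)).
  { apply (is_RInt_gen_plus (V := R_NormedModule) (fun s => a * g s) (fun s => b * h s));
    apply (is_RInt_gen_scal (V := R_NormedModule));
    now apply int_from_correct. }
  split; [eexists; exact H|].
  now apply int_from_unique.
Qed.

Lemma int_from_ext (t : R) (g h : R -> R) :
  (forall s, t <= s -> g s = h s) -> ex_int_from g t ->
  ex_int_from h t /\ int_from g t = int_from h t.
Proof.
  intros hgh hg.
  assert (H : filter_prod (at_point t) (Rbar_locally p_infty)
    (fun ab : R * R => forall x, Rmin (fst ab) (snd ab) < x < Rmax (fst ab) (snd ab)
      -> g x = h x)).
  { apply (Filter_prod _ _ _ (fun s => s = t) (fun T => t < T)); [reflexivity| now exists t|].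
    intros s T -> hT x [hx _]. simpl in hx. rewrite Rmin_left in hx by lra.
    apply hgh; lra. }
  assert (hi := int_from_correct t g hg).
  apply (is_RInt_gen_ext (V := R_NormedModule) g h) in hi; [|exact H].
  split; [eexists; exact hi|].
  symmetry. now apply int_from_unique.
Qed.

Lemma int_from_minus (t : R) (g h : R -> R) :
  ex_int_from g t -> ex_int_from h t ->
  ex_int_from (fun s => g s - h s) t /\
  int_from (fun s => g s - h s) t = int_from g t - int_from h t.
Proof.
  intros hg hh. destruct (int_from_lin t 1 (-1) g h hg hh) as [h1 h2].
  destruct (int_from_ext t (fun s => 1 * g s + -1 * h s) (fun s => g s - h s)
              ltac:(intros; cbv beta; ring) h1) as [h3 h4].
  split; [assumption|]. rewrite <- h4, h2. ring.
Qed.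

Lemma int_from_le (t : R) (g h : R -> R) :
  ex_int_from g t -> ex_int_from h t ->
  (forall s, t <= s -> g s <= h s) -> int_from g t <= int_from h t.
Proof.
  intros hg hh hle. destruct (int_from_minus t h g hh hg) as [hex heq].
  assert (H : Rabs (int_from (fun s => h s - g s) t) <= int_from (fun s => h s - g s) t).
  { apply Rabs_int_from_le; auto. intros s hs. specialize (hle s hs).
    rewrite Rabs_pos_eq; lra. }
  assert (H' := Rabs_pos (int_from (fun s => h s - g s) t)). lra.
Qed.

Lemma int_from_antitone (t0 t : R) (g : R -> R) :
  continuous_on (halfline t0) g -> ex_int_from g t0 ->
  (forall s, t0 <= s -> 0 <= g s) -> t0 <= t -> int_from g t <= int_from g t0.
Proof.
  intros hg hex hpos ht.
  destruct (int_from_Chasles t0 t g hg hex ht) as [_ ->].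
  assert (0 <= RInt g t0 t); [|lra].
  apply RInt_ge_0; [assumption| |].
  - apply ex_RInt_halfline with t0; auto; lra.
  - intros s hs. apply hpos; lra.
Qed.

(** Cauchy criterion: the oscillation of the integral of g over a tail is
    dominated by that of h. *)
Lemma ex_int_from_comparison (t : R) (g h : R -> R) :
  continuous_on (halfline t) g -> continuous_on (halfline t) h ->
  (forall s, t <= s -> Rabs (g s) <= h s) -> ex_int_from h t ->
  ex_int_from g t.
Proof.
  intros hg hh hle hex.
  assert (hbound : forall S T, t <= S -> S <= T ->
            Rabs (RInt g t T - RInt g t S) <= RInt h t T - RInt h t S).
  { intros S T hS hT.
    assert (hC : forall k, continuous_on (halfline t) k ->
              RInt k t T - RInt k t S = RInt k S T).
    { intros k hk.
      rewrite <- (RInt_Chasles (V := R_CompleteNormedModule) k t S T)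
        by (apply ex_RInt_halfline with t; auto; lra).
      unfold plus; simpl; ring. }
    rewrite !hC by assumption.
    apply Rle_trans with (RInt (fun s => Rabs (g s)) S T).
    - apply abs_RInt_le; [assumption|]. apply ex_RInt_halfline with t; auto; lra.
    - apply RInt_le; [assumption| | |].
      + apply (ex_RInt_norm g). apply ex_RInt_halfline with t; auto; lra.
      + apply ex_RInt_halfline with t; auto; lra.
      + intros x hx. apply hle; lra. }
  assert (hcv : exists l, filterlim (fun T => RInt g t T) (Rbar_locally p_infty) (locally l)).
  { apply (filterlim_locally_cauchy (U := R_CompleteSpace)). intros eps.
    assert (hlim := int_from_is_lim t h hh hex).
    apply (filterlim_locally (F := Rbar_locally p_infty)) with (eps := pos_div_2 eps) in hlim.
    exists (fun T => t < T /\ Rabs (RInt h t T - int_from h t) < eps / 2). split.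
    - apply filter_and; [now exists t|exact hlim].
    - intros S T [hS1 hS2] [hT1 hT2].
      change (Rabs (RInt g t T - RInt g t S) < eps).
      apply Rabs_def2 in hS2. apply Rabs_def2 in hT2.
      destruct (Rle_dec S T) as [hST|hTS].
      + specialize (hbound S T ltac:(lra) hST). lra.
      + specialize (hbound T S ltac:(lra) ltac:(lra)).
        rewrite Rabs_minus_sym. lra. }
  destruct hcv as [l hl]. now apply (is_lim_int_from t l g).
Qed.

(** The fundamental theorem of calculus for derivatives taken within the
    half-line. Since [y] may fail to be differentiable, or even continuous, from the
    left at [t0], the mean value theorem is applied to the extension of [y] minus
    the primitive of the extension of [dy]: this is continuous on [[a, b]] and has zero
    derivative inside. *)
Lemma RInt_D_in (t0 a b : R) (y dy : R -> R) :
  (forall t, t0 <= t -> D_in y dy (halfline t0) t) ->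
  continuous_on (halfline t0) dy -> t0 <= a -> a <= b ->
  RInt dy a b = y b - y a.
Proof.
  intros hy hdy ha hab.
  assert (hyc := D_in_continuous_on _ _ _ hy).
  set (Y := fun s => y (Rmax t0 s)). set (dY := fun s => dy (Rmax t0 s)).
  destruct (MVT_gen (fun s => Y s - RInt dY a s) a b (fun _ => 0)) as [c [_ hc]].
  - intros x [hx _]. rewrite Rmin_left in hx by lra.
    replace 0 with (dY x - dY x) by ring.
    apply (is_derive_minus (V := R_NormedModule)).
    + apply is_derive_ext_loc with y.
      * exists (mkposreal (x - a) ltac:(lra)). intros s hs.
        apply Rabs_def2 in hs. simpl in hs. unfold minus, plus, opp in hs; simpl in hs.
        unfold Y. rewrite Rmax_right; [reflexivity|lra].
      * unfold dY. rewrite Rmax_right by lra. apply D_in_is_derive with t0; [lra|].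
        apply hy; lra.
    + apply is_derive_RInt with a; [|now apply continuous_extend].
      apply filter_forall. intros s.
      apply (RInt_correct (V := R_CompleteNormedModule)),
        (ex_RInt_continuous (V := R_CompleteNormedModule)).
      intros; now apply continuous_extend.
  - intros x _. apply continuity_pt_filterlim.
    apply (continuous_minus (V := R_NormedModule)); [now apply continuous_extend|].
    apply (ex_derive_continuous (V := R_NormedModule)). exists (dY x).
    apply is_derive_RInt with a; [|now apply continuous_extend].
    apply filter_forall. intros s.
    apply (RInt_correct (V := R_CompleteNormedModule)),
      (ex_RInt_continuous (V := R_CompleteNormedModule)).
    intros; now apply continuous_extend.
  - rewrite RInt_point in hc. unfold Y in hc. rewrite !Rmax_right in hc by lra.
    rewrite <- (RInt_ext dY dy).
    + unfold zero in hc; simpl in hc. lra.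
    + intros x [hx _]. rewrite Rmin_left in hx by lra. unfold dY.
      rewrite Rmax_right; [reflexivity|lra].
Qed.

Lemma int_from_D_in (t0 l : R) (y dy : R -> R) :
  (forall t, t0 <= t -> D_in y dy (halfline t0) t) ->
  continuous_on (halfline t0) dy -> is_lim y p_infty l ->
  forall t, t0 <= t -> ex_int_from dy t /\ int_from dy t = l - y t.
Proof.
  intros hy hdy hl t ht.
  apply is_lim_int_from; [now apply continuous_on_halfline_le with t0|].
  apply is_lim_ext_loc with (fun T => y T - y t).
  - exists t. intros T hT. symmetry. apply RInt_D_in with t0; auto; lra.
  - apply is_lim_minus'; [assumption|apply is_lim_const].
Qed.

(** * Comparison and iterated tail integrals *)

Lemma continuous_on_mult (D : R -> Prop) (g h : R -> R) :
  continuous_on D g -> continuous_on D h -> continuous_on D (fun s => g s * h s).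
Proof.
  intros hg hh t ht.
  apply (filterlim_comp_2 (G := locally (g t)) (H := locally (h t)) g h Rmult);
    [now apply hg|now apply hh|apply (filterlim_mult (K := R_AbsRing))].
Qed.

Lemma continuous_on_lin (D : R -> Prop) (a b : R) (g h : R -> R) :
  continuous_on D g -> continuous_on D h ->
  continuous_on D (fun s => a * g s + b * h s).
Proof.
  intros hg hh t ht.
  assert (hconst : forall c : R, continuous_on D (fun _ => c)).
  { intros c. apply continuous_on_forall. intros s _. apply continuous_const. }
  apply (filterlim_comp_2 (G := locally (a * g t)) (H := locally (b * h t))
           (fun s => a * g s) (fun s => b * h s) Rplus).
  - now apply (continuous_on_mult D (fun _ => a) g).
  - now apply (continuous_on_mult D (fun _ => b) h).
  - apply (filterlim_plus (V := R_NormedModule)).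
Qed.

(** Comparison applies to v - a, which lies between 0 and the integrable
    function b - a. *)
Lemma ex_int_from_squeeze (t : R) (a v b : R -> R) :
  continuous_on (halfline t) a -> continuous_on (halfline t) v ->
  continuous_on (halfline t) b -> ex_int_from a t -> ex_int_from b t ->
  (forall s, t <= s -> a s <= v s <= b s) -> ex_int_from v t.
Proof.
  intros ha hv hb hai hbi hle.
  assert (hva : ex_int_from (fun s => 1 * v s + -1 * a s) t).
  { apply ex_int_from_comparison with (fun s => 1 * b s + -1 * a s).
    - now apply continuous_on_lin.
    - now apply continuous_on_lin.
    - intros s hs. specialize (hle s hs). rewrite Rabs_pos_eq; lra.
    - now apply int_from_lin. }
  apply (int_from_ext t (fun s => 1 * (1 * v s + -1 * a s) + 1 * a s)).
  - intros s _. ring.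
  - now apply (int_from_lin t 1 1 (fun s => 1 * v s + -1 * a s) a).
Qed.

(** Tonelli's formula for the iterated tail integral, by parts instead of by
    exchanging integrals: (s - t0) G(s) - int_s^oo (r - t0) g, where
    G(s) = int_s^oo g, has derivative G. It vanishes at infinity because
    (s - t0) G(s) <= int_s^oo (r - t0) g, and its value at t0 is minus the
    moment of g. *)
Lemma int_from_int_from (t0 : R) (g : R -> R) :
  continuous_on (halfline t0) g -> (forall s, t0 <= s -> 0 <= g s) ->
  ex_int_from g t0 -> ex_int_from (fun s => (s - t0) * g s) t0 ->
  ex_int_from (int_from g) t0 /\
  int_from (int_from g) t0 = int_from (fun s => (s - t0) * g s) t0.
Proof.
  intros hg hpos hex hmom.
  set (m := fun s => (s - t0) * g s).
  assert (hm : continuous_on (halfline t0) m).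
  { apply continuous_on_mult; [|assumption].
    apply continuous_on_forall. intros s _.
    apply (continuous_minus (V := R_NormedModule) (fun s => s) (fun _ => t0));
      [apply continuous_id|apply continuous_const]. }
  assert (hexs : forall s, t0 <= s -> ex_int_from g s /\ ex_int_from m s).
  { intros s hs. split; now apply int_from_Chasles with t0. }
  set (y := fun s => (s - t0) * int_from g s - int_from m s).
  assert (hy : forall t, t0 <= t -> D_in y (int_from g) (halfline t0) t).
  { intros t ht.
    apply D_in_ext with y
      (fun s => (1 * int_from g s + (s - t0) * (- g s)) - (- m s)); auto.
    - unfold m. ring.
    - apply Dminus; [|now apply D_in_int_from].
      apply (Dmult _ (fun _ => 1) (fun s => - g s) (fun s => s - t0) (int_from g));
        [|now apply D_in_int_from].
      apply is_derive_D_in. auto_derive; [trivial|ring]. }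
  assert (hlim : is_lim y p_infty 0).
  { assert (hm0 := is_lim_int_from_0 t0 m hm hmom).
    replace (Finite 0) with (Finite (0 - 0)) by (f_equal; ring).
    apply is_lim_minus'; [|assumption].
    apply is_lim_le_le_loc with (fun _ => 0) (int_from m);
      [|apply is_lim_const|assumption].
    exists t0. intros s hs. destruct (hexs s ltac:(lra)) as [hgs hms].
    destruct (int_from_scal s (s - t0) g hgs) as [h1 h2].
    split.
    - apply Rmult_le_pos; [lra|]. apply int_from_nonneg; [assumption|].
      intros r hr. apply hpos; lra.
    - rewrite <- h2. apply int_from_le; auto.
      intros r hr. unfold m. apply Rmult_le_compat_r; [apply hpos|]; lra. }
  destruct (int_from_D_in t0 0 y (int_from g) hy) with t0 as [h1 h2];
    auto using continuous_on_int_from; [lra|].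
  split; [assumption|]. rewrite h2. unfold y. ring.
Qed.

(** The estimate behind the contraction: a bound on two integrands passes to
    their tail integrals through the masses of k1 and k2, and to their iterated
    tail integrals through the first moments. *)
Lemma iterated_tail_estimate (t0 d1 d2 : R) (k1 k2 F1 F2 : R -> R) :
  continuous_on (halfline t0) k1 -> continuous_on (halfline t0) k2 ->
  (forall t, t0 <= t -> 0 <= k1 t) -> (forall t, t0 <= t -> 0 <= k2 t) ->
  ex_int_from k1 t0 -> ex_int_from (fun t => (t - t0) * k1 t) t0 ->
  ex_int_from k2 t0 -> ex_int_from (fun t => (t - t0) * k2 t) t0 ->
  0 <= d1 -> 0 <= d2 ->
  continuous_on (halfline t0) F1 -> continuous_on (halfline t0) F2 ->
  ex_int_from F1 t0 -> ex_int_from F2 t0 ->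
  ex_int_from (int_from F1) t0 -> ex_int_from (int_from F2) t0 ->
  (forall t, t0 <= t -> Rabs (F2 t - F1 t) <= d1 * k1 t + d2 * k2 t) ->
  forall t, t0 <= t ->
    Rabs (int_from F2 t - int_from F1 t) <= d1 * int_from k1 t0 + d2 * int_from k2 t0 /\
    Rabs (int_from (int_from F2) t - int_from (int_from F1) t)
    <= d1 * int_from (fun t => (t - t0) * k1 t) t0
       + d2 * int_from (fun t => (t - t0) * k2 t) t0.
Proof.
  intros hk1 hk2 hp1 hp2 hi1 hm1 hi2 hm2 hd1 hd2 hF1 hF2 hI1 hI2 hJ1 hJ2 hF.
  set (g := fun t => d1 * k1 t + d2 * k2 t).
  assert (hg : continuous_on (halfline t0) g) by now apply continuous_on_lin.
  assert (hpos : forall t, t0 <= t -> 0 <= g t).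
  { intros t ht. unfold g. specialize (hp1 t ht). specialize (hp2 t ht).
    apply Rplus_le_le_0_compat; now apply Rmult_le_pos. }
  destruct (int_from_lin t0 d1 d2 k1 k2 hi1 hi2) as [hgi hgv].
  destruct (int_from_lin t0 d1 d2 _ _ hm1 hm2) as [hgm hgmv].
  destruct (int_from_ext t0
              (fun t => d1 * ((t - t0) * k1 t) + d2 * ((t - t0) * k2 t))
              (fun t => (t - t0) * g t) ltac:(intros; unfold g; ring) hgm) as [hgm' hgmv'].
  rewrite hgmv' in hgmv.
  destruct (int_from_int_from t0 g hg hpos hgi hgm') as [hG hGv].
  assert (hw : forall t, t0 <= t ->
            Rabs (int_from F2 t - int_from F1 t) <= int_from g t).
  { intros t ht.
    destruct (int_from_Chasles t0 t F1 hF1 hI1 ht) as [h1 _].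
    destruct (int_from_Chasles t0 t F2 hF2 hI2 ht) as [h2 _].
    destruct (int_from_Chasles t0 t g hg hgi ht) as [h3 _].
    destruct (int_from_minus t F2 F1 h2 h1) as [h4 <-].
    apply Rabs_int_from_le; auto. intros s hs. apply hF; lra. }
  intros t ht. split.
  - rewrite <- hgv. apply Rle_trans with (int_from g t); [now apply hw|].
    now apply int_from_antitone.
  - rewrite <- hgmv, <- hGv.
    assert (hGc := continuous_on_int_from t0 g hg hgi).
    apply Rle_trans with (int_from (int_from g) t).
    + destruct (int_from_Chasles t0 t (int_from F1)) as [h1 _];
        auto using continuous_on_int_from.
      destruct (int_from_Chasles t0 t (int_from F2)) as [h2 _];
        auto using continuous_on_int_from.
      destruct (int_from_Chasles t0 t (int_from g) hGc hG ht) as [h3 _].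
      destruct (int_from_minus t _ _ h2 h1) as [h4 <-].
      apply Rabs_int_from_le; auto. intros s hs. apply hw; lra.
    + apply int_from_antitone; auto. intros s hs. apply int_from_nonneg.
      * now apply int_from_Chasles with t0.
      * intros r hr. apply hpos; lra.
Qed.

(** * Bounds, uniform limits and geometric sequences *)

Lemma bounded_on_halfline (t0 l : R) (g : R -> R) :
  continuous_on (halfline t0) g -> is_lim g p_infty l ->
  exists B, forall t, t0 <= t -> Rabs (g t) <= B.
Proof.
  intros hg hl.
  apply (filterlim_locally (F := Rbar_locally p_infty)) with (eps := mkposreal 1 Rlt_0_1) in hl.
  destruct hl as [N hN]. simpl in hN.
  destruct (bounded_continuity (V := R_NormedModule) (fun s => g (Rmax t0 s)) t0 (Rmax t0 N))
    as [B hB].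
  - intros x _. now apply continuous_extend.
  - exists (Rmax B (Rabs l + 1)). intros t ht.
    destruct (Rle_dec t N) as [htN|htN].
    + apply Rle_trans with (2 := Rmax_l _ _). apply Rlt_le.
      specialize (hB t). rewrite (Rmax_right t0 t ht) in hB. apply hB.
      split; [assumption|]. apply Rle_trans with (1 := htN), Rmax_r.
    + apply Rle_trans with (2 := Rmax_r _ _).
      assert (h : Rabs (g t - l) < 1) by (apply hN; lra).
      replace (g t) with (l + (g t - l)) by ring.
      apply Rle_trans with (1 := Rabs_triang _ _). lra.
Qed.

Lemma uniform_limit_continuous_on (t0 : R) (u : R -> R) :
  (forall eps, 0 < eps -> exists g, continuous_on (halfline t0) g /\
     forall t, t0 <= t -> Rabs (g t - u t) <= eps) ->
  continuous_on (halfline t0) u.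
Proof.
  intros h t ht P [eps hP].
  destruct (h (eps / 4)) as [g [hg hgu]]; [assert (h0 := cond_pos eps); lra|].
  specialize (hg t ht).
  apply (filterlim_locally (F := within (halfline t0) (locally t))) with (eps := pos_div_2 eps) in hg.
  destruct hg as [d hd].
  exists d. intros s hs hst. apply hP.
  specialize (hd s hs hst).
  change (Rabs (g s - g t) < eps / 2) in hd. change (Rabs (u s - u t) < eps).
  assert (h1 := hgu s hst). assert (h2 := hgu t ht).
  apply Rabs_def2 in hd. apply Rabs_le_between in h1. apply Rabs_le_between in h2.
  apply Rabs_def1; lra.
Qed.

Lemma geometric_small (c q eps : R) :
  0 <= q < 1 -> 0 < eps -> exists n, c * q ^ n <= eps.
Proof.
  intros hq heps.
  assert (h : is_lim_seq (fun n => c * q ^ n) 0).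
  { replace (Finite 0) with (Rbar_mult c 0) by (simpl; f_equal; ring).
    apply is_lim_seq_scal_l, is_lim_seq_geom. rewrite Rabs_pos_eq; lra. }
  apply is_lim_seq_spec in h. destruct (h (mkposreal eps heps)) as [N hN].
  exists N. specialize (hN N (le_n N)). simpl in hN. rewrite Rminus_0_r in hN.
  apply Rabs_def2 in hN. lra.
Qed.

(** Stated for the total operator [Lim_seq], so that a sequence of functions can
    be sent to its pointwise limit with no choice of limits. *)
Lemma geometric_limit (x : nat -> R) (c q : R) :
  0 <= q < 1 -> (forall n, Rabs (x (S n) - x n) <= c * q ^ n) ->
  forall n, Rabs (x n - real (Lim_seq x)) <= c / (1 - q) * q ^ n.
Proof.
  intros hq hx.
  assert (hc : 0 <= c).
  { apply Rle_trans with (1 := Rabs_pos _) (2 := Rle_trans _ _ _ (hx 0%nat) (Req_le _ _ (Rmult_1_r c))). }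
  assert (hcq : 0 <= c / (1 - q)) by (apply Rdiv_le_0_compat; lra).
  (* telescoping form of the geometric bound, stable under induction on k *)
  assert (hsum : forall n k, Rabs (x n - x (n + k)%nat)
            <= c / (1 - q) * q ^ n - c / (1 - q) * q ^ (n + k)).
  { intros n k. induction k as [|k IH].
    - rewrite Nat.add_0_r, Rminus_diag, Rabs_R0. lra.
    - rewrite Nat.add_succ_r.
      replace (x n - x (S (n + k))) with ((x n - x (n + k)%nat) - (x (S (n + k)) - x (n + k)%nat)) by ring.
      apply Rle_trans with (1 := Rabs_triang _ _). rewrite Rabs_Ropp.
      specialize (hx (n + k)%nat).
      replace (c / (1 - q) * q ^ n - c / (1 - q) * q ^ S (n + k))
        with ((c / (1 - q) * q ^ n - c / (1 - q) * q ^ (n + k)) + c * q ^ (n + k))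
        by (simpl; field; lra).
      lra. }
  assert (hle : forall n k, Rabs (x n - x (n + k)%nat) <= c / (1 - q) * q ^ n).
  { intros n k. specialize (hsum n k).
    assert (0 <= c / (1 - q) * q ^ (n + k)); [|lra].
    apply Rmult_le_pos; [assumption|]. apply pow_le; lra. }
  assert (hcv : ex_finite_lim_seq x).
  { apply ex_lim_seq_cauchy_corr. intros eps.
    assert (heps := cond_pos eps).
    destruct (geometric_small (c / (1 - q)) q (eps / 4) hq) as [N hN]; [lra|].
    exists N. intros n m hn hm.
    assert (h1 := hle N (n - N)%nat). assert (h2 := hle N (m - N)%nat).
    replace (N + (n - N))%nat with n in h1 by now rewrite Nat.add_comm, Nat.sub_add.
    replace (N + (m - N))%nat with m in h2 by now rewrite Nat.add_comm, Nat.sub_add.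
    apply Rabs_le_between in h1. apply Rabs_le_between in h2. apply Rabs_def1; lra. }
  apply ex_finite_lim_seq_correct in hcv. destruct hcv as [hcv hfin].
  apply Lim_seq_correct in hcv. rewrite <- hfin in hcv.
  intros n.
  apply (is_lim_seq_le (fun k => Rabs (x n - x (n + k)%nat)) (fun _ => c / (1 - q) * q ^ n)
           (Rabs (x n - real (Lim_seq x))) (c / (1 - q) * q ^ n)).
  - apply hle.
  - apply (is_lim_seq_abs _ (Finite (x n - real (Lim_seq x)))).
    apply is_lim_seq_minus'; [apply is_lim_seq_const|].
    apply is_lim_seq_ext with (fun k => x (k + n)%nat).
    + intros k. now rewrite Nat.add_comm.
    + now apply is_lim_seq_incr_n.
  - apply is_lim_seq_const.
Qed.

(** * Contractions on pairs of functions *)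

(** The weighted supremum distance on the half-line is at most [d]. A
    relation, rather than a real-valued distance, avoids suprema that could be
    infinite and identifies functions agreeing on the half-line. *)
Definition close (t0 zeta d : R) (p q : (R -> R) * (R -> R)) : Prop :=
  forall t, t0 <= t ->
    Rabs (fst p t - fst q t) <= d /\ zeta * Rabs (snd p t - snd q t) <= d.

Lemma close_sym (t0 zeta d : R) (p q : (R -> R) * (R -> R)) :
  close t0 zeta d p q -> close t0 zeta d q p.
Proof.
  intros h t ht. rewrite (Rabs_minus_sym (fst q t)), (Rabs_minus_sym (snd q t)). now apply h.
Qed.

Lemma close_trans (t0 zeta d e : R) (p q r : (R -> R) * (R -> R)) :
  0 <= zeta -> close t0 zeta d p q -> close t0 zeta e q r ->
  close t0 zeta (d + e) p r.
Proof.
  intros hz h1 h2 t ht. destruct (h1 t ht) as [h3 h4]. destruct (h2 t ht) as [h5 h6].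
  assert (tri : forall a b c, Rabs (a - c) <= Rabs (a - b) + Rabs (b - c)).
  { intros a b c. replace (a - c) with ((a - b) + (b - c)) by ring. apply Rabs_triang. }
  split.
  - apply Rle_trans with (1 := tri _ (fst q t) _). lra.
  - apply Rle_trans with (1 := Rmult_le_compat_l _ _ _ hz (tri _ (snd q t) _)). lra.
Qed.

Lemma close_weaken (t0 zeta d e : R) (p q : (R -> R) * (R -> R)) :
  d <= e -> close t0 zeta d p q -> close t0 zeta e p q.
Proof. intros hde h t ht. destruct (h t ht). lra. Qed.

Lemma close_0 (t0 zeta : R) (p q : (R -> R) * (R -> R)) :
  0 < zeta -> (forall eps, 0 < eps -> close t0 zeta eps p q) ->
  forall t, t0 <= t -> fst p t = fst q t /\ snd p t = snd q t.
Proof.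
  intros hz h t ht.
  assert (h1 : Rabs (fst p t - fst q t) <= 0).
  { apply le_epsilon. intros eps heps. rewrite Rplus_0_l. now apply h. }
  assert (h2 : zeta * Rabs (snd p t - snd q t) <= 0).
  { apply le_epsilon. intros eps heps. rewrite Rplus_0_l. now apply h. }
  assert (h3 : Rabs (snd p t - snd q t) <= 0) by (apply Rmult_le_reg_l with zeta; lra).
  apply Rabs_le_between in h1. apply Rabs_le_between in h3. lra.
Qed.

(** Banach's fixed point theorem on the set P. The iterates of p0 converge
    geometrically and uniformly to their pointwise limit, which belongs to P by
    closedness and is fixed because Phi is Lipschitz. *)
Lemma contraction_fixed_point (t0 zeta q c : R)
    (P : (R -> R) * (R -> R) -> Prop)
    (Phi : (R -> R) * (R -> R) -> (R -> R) * (R -> R)) (p0 : (R -> R) * (R -> R)) :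
  0 < zeta -> 0 <= q < 1 -> P p0 -> (forall p, P p -> P (Phi p)) ->
  close t0 zeta c p0 (Phi p0) ->
  (forall p r d, 0 <= d -> P p -> P r -> close t0 zeta d p r ->
     close t0 zeta (q * d) (Phi p) (Phi r)) ->
  (forall p, (forall eps, 0 < eps -> exists r, P r /\ close t0 zeta eps r p) -> P p) ->
  exists p, P p /\
    forall t, t0 <= t -> fst p t = fst (Phi p) t /\ snd p t = snd (Phi p) t.
Proof.
  intros hz hq hp0 hPhi hc hcontr hclosed.
  assert (hc0 : 0 <= c).
  { apply Rle_trans with (1 := Rabs_pos (fst p0 t0 - fst (Phi p0) t0)).
    apply (hc t0 (Rle_refl t0)). }
  set (x := fun n => Nat.iter n Phi p0).
  assert (hx : forall n, P (x n)) by (induction n; simpl; auto).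
  assert (hstep : forall n, close t0 zeta (c * q ^ n) (x n) (x (S n))).
  { induction n as [|n IH].
    - now rewrite Rmult_1_r.
    - replace (c * q ^ S n) with (q * (c * q ^ n)) by (simpl; ring).
      apply hcontr; auto. apply Rmult_le_pos; [assumption|]. apply pow_le; lra. }
  set (p := (fun t => real (Lim_seq (fun n => fst (x n) t)),
             fun t => real (Lim_seq (fun n => snd (x n) t)))).
  set (C := c / (1 - q)).
  assert (hC : 0 <= C) by (apply Rdiv_le_0_compat; lra).
  assert (hlim : forall n, close t0 zeta (C * q ^ n) (x n) p).
  { intros n t ht. split.
    - apply (geometric_limit (fun n => fst (x n) t)); [assumption|].
      intros k. rewrite Rabs_minus_sym. now apply hstep.
    - apply Rmult_le_reg_l with (/ zeta); [now apply Rinv_0_lt_compat|].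
      rewrite <- Rmult_assoc, Rinv_l, Rmult_1_l by lra.
      replace (/ zeta * (C * q ^ n)) with ((c / zeta) / (1 - q) * q ^ n)
        by (unfold C; field; lra).
      apply (geometric_limit (fun n => snd (x n) t)); [assumption|].
      intros k. rewrite Rabs_minus_sym.
      apply Rmult_le_reg_l with zeta; [assumption|].
      replace (zeta * (c / zeta * q ^ k)) with (c * q ^ k) by (field; lra).
      now apply hstep. }
  assert (hP : P p).
  { apply hclosed. intros eps heps. destruct (geometric_small C q eps hq heps) as [n hn].
    exists (x n). split; [apply hx|]. now apply close_weaken with (C * q ^ n). }
  exists p. split; [assumption|].
  apply (close_0 t0 zeta p (Phi p) hz). intros eps heps.
  destruct (geometric_small (2 * C * q) q eps hq heps) as [n hn].
  apply close_weaken with (C * q ^ S n + q * (C * q ^ n)).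
  - simpl. lra.
  - apply close_trans with (x (S n)); [lra|apply close_sym, hlim|].
    apply hcontr; auto. apply Rmult_le_pos; [assumption|]. apply pow_le; lra.
Qed.

(** Two fixed points within distance d are within q^n d for every n. *)
Lemma contraction_unique (t0 zeta q d : R) (P : (R -> R) * (R -> R) -> Prop)
    (Phi : (R -> R) * (R -> R) -> (R -> R) * (R -> R)) (p r : (R -> R) * (R -> R)) :
  0 < zeta -> 0 <= q < 1 ->
  (forall p r d, 0 <= d -> P p -> P r -> close t0 zeta d p r ->
     close t0 zeta (q * d) (Phi p) (Phi r)) ->
  P p -> P r -> 0 <= d -> close t0 zeta d p r ->
  (forall t, t0 <= t -> fst p t = fst (Phi p) t /\ snd p t = snd (Phi p) t) ->
  (forall t, t0 <= t -> fst r t = fst (Phi r) t /\ snd r t = snd (Phi r) t) ->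
  forall t, t0 <= t -> fst p t = fst r t /\ snd p t = snd r t.
Proof.
  intros hz hq hcontr hp hr hd hpr hfp hfr.
  assert (h : forall n, close t0 zeta (d * q ^ n) p r).
  { induction n as [|n IH].
    - now rewrite Rmult_1_r.
    - intros t ht. destruct (hfp t ht) as [-> ->]. destruct (hfr t ht) as [-> ->].
      replace (d * q ^ S n) with (q * (d * q ^ n)) by (simpl; ring).
      revert t ht. apply hcontr; auto.
      apply Rmult_le_pos; [assumption|]. apply pow_le; lra. }
  apply (close_0 t0 zeta p r hz). intros eps heps.
  destruct (geometric_small d q eps hq heps) as [n hn].
  now apply close_weaken with (d * q ^ n).
Qed.

(** * The integral operator of the boundary value problem *)

Definition picard (M : R) (f : R -> R -> R -> R) (p : (R -> R) * (R -> R)) :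
    (R -> R) * (R -> R) :=
  let w := int_from (fun s => f s (fst p s) (snd p s)) in
  (fun t => M - int_from w t, w).

Definition admissible (t0 M : R) (alpha beta : R -> R) (p : (R -> R) * (R -> R)) : Prop :=
  in_C t0 M alpha beta (fst p) /\ in_D t0 alpha beta (snd p).

Lemma continuous_on_nonlinearity (t0 : R) (f : R -> R -> R -> R) (u v : R -> R) :
  continuous_nonlinearity t0 f ->
  continuous_on (halfline t0) u -> continuous_on (halfline t0) v ->
  continuous_on (halfline t0) (fun s => f s (u s) (v s)).
Proof.
  intros hf hu hv t ht.
  specialize (hf (t, u t, v t) ht). simpl in hf.
  apply (filterlim_comp _ _ _ (fun s => (s, u s, v s))
           (fun p => f (fst (fst p)) (snd (fst p)) (snd p)) _ _ _) with (2 := hf).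
  intros P [eps hP].
  specialize (hu t ht). specialize (hv t ht).
  apply (filterlim_locally (F := within (halfline t0) (locally t))) with (eps := eps) in hu.
  apply (filterlim_locally (F := within (halfline t0) (locally t))) with (eps := eps) in hv.
  destruct hu as [d1 h1], hv as [d2 h2].
  assert (hm : 0 < Rmin eps (Rmin d1 d2)) by (repeat apply Rmin_glb_lt; apply cond_pos).
  exists (mkposreal _ hm). intros s hs hst. apply hP; [|assumption].
  assert (hs1 := Rlt_le_trans _ _ _ hs (Rmin_l _ _)).
  assert (hs2 := Rlt_le_trans _ _ _ hs (Rmin_r _ _)).
  repeat split.
  - exact hs1.
  - apply h1; [|assumption]. exact (Rlt_le_trans _ _ _ hs2 (Rmin_l _ _)).
  - apply h2; [|assumption]. exact (Rlt_le_trans _ _ _ hs2 (Rmin_r _ _)).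
Qed.

Lemma abs_integrable_ex_int_from (t0 : R) (g : R -> R) :
  continuous_on (halfline t0) g -> abs_integrable t0 g -> ex_int_from g t0.
Proof.
  intros hg hex. apply ex_int_from_comparison with (fun s => Rabs (g s)); auto.
  - intros t ht. apply (filterlim_comp _ _ _ g Rabs _ (locally (g t))); [now apply hg|].
    apply (continuous_abs (g t)).
  - intros; apply Rle_refl.
Qed.

Lemma in_D_ex_int_from (t0 : R) (alpha beta v : R -> R) :
  continuous_on (halfline t0) alpha -> continuous_on (halfline t0) beta ->
  ex_int_from alpha t0 -> ex_int_from beta t0 -> in_D t0 alpha beta v ->
  ex_int_from v t0.
Proof. intros ha hb hai hbi [hv hle]. now apply ex_int_from_squeeze with alpha beta. Qed.

Lemma in_C_antiderivative (t0 M : R) (alpha beta v : R -> R) :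
  continuous_on (halfline t0) alpha -> continuous_on (halfline t0) beta ->
  ex_int_from alpha t0 -> ex_int_from beta t0 -> in_D t0 alpha beta v ->
  in_C t0 M alpha beta (fun t => M - int_from v t).
Proof.
  intros ha hb hai hbi hD.
  assert (hvi := in_D_ex_int_from t0 alpha beta v ha hb hai hbi hD).
  destruct hD as [hv hle].
  split.
  - apply D_in_continuous_on with (fun t => 0 - - v t). intros t ht.
    apply Dminus; [apply Dconst|now apply D_in_int_from].
  - intros t ht.
    assert (hex : forall g, continuous_on (halfline t0) g -> ex_int_from g t0 -> ex_int_from g t)
      by (intros g hg hgi; now apply int_from_Chasles with t0).
    assert (int_from alpha t <= int_from v t).
    { apply int_from_le; auto. intros s hs. apply hle; lra. }
    assert (int_from v t <= int_from beta t).
    { apply int_from_le; auto. intros s hs. apply hle; lra. }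
    lra.
Qed.

Lemma admissible_closed (t0 M zeta : R) (alpha beta : R -> R) (p : (R -> R) * (R -> R)) :
  0 < zeta ->
  (forall eps, 0 < eps -> exists r, admissible t0 M alpha beta r /\ close t0 zeta eps r p) ->
  admissible t0 M alpha beta p.
Proof.
  intros hz h.
  assert (hv : forall eps, 0 < eps -> exists r, admissible t0 M alpha beta r /\
     forall t, t0 <= t -> Rabs (snd r t - snd p t) <= eps).
  { intros eps heps. destruct (h (zeta * eps)) as [r [hr hc]];
      [now apply Rmult_lt_0_compat|].
    exists r. split; [assumption|]. intros t ht.
    apply Rmult_le_reg_l with zeta; [assumption|]. now apply hc. }
  assert (hlim : forall a b x, (forall eps, 0 < eps -> exists y, a <= y <= b /\ Rabs (y - x) <= eps)
            -> a <= x <= b).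
  { intros a b x hx. split; apply le_epsilon; intros eps heps;
      destruct (hx eps heps) as [y [hy hyx]]; apply Rabs_le_between in hyx; lra. }
  split; split.
  - apply uniform_limit_continuous_on. intros eps heps.
    destruct (h eps heps) as [r [[[hr _] _] hc]]. exists (fst r).
    split; [assumption|]. intros t ht. now apply hc.
  - intros t ht. apply hlim. intros eps heps.
    destruct (h eps heps) as [r [[[_ hr] _] hc]]. exists (fst r t).
    split; [now apply hr|now apply hc].
  - apply uniform_limit_continuous_on. intros eps heps.
    destruct (hv eps heps) as [r [[_ [hr _]] hc]]. exists (snd r). now split.
  - intros t ht. apply hlim. intros eps heps.
    destruct (hv eps heps) as [r [[_ [_ hr]] hc]]. exists (snd r t).
    split; [now apply hr|now apply hc].
Qed.

Lemma bounded_between (t0 l m : R) (a b : R -> R) :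
  continuous_on (halfline t0) a -> continuous_on (halfline t0) b ->
  is_lim a p_infty l -> is_lim b p_infty m ->
  exists B, 0 <= B /\ forall t x y, t0 <= t ->
    a t <= x <= b t -> a t <= y <= b t -> Rabs (x - y) <= B.
Proof.
  intros ha hb hla hlb.
  destruct (bounded_on_halfline t0 l a ha hla) as [A hA].
  destruct (bounded_on_halfline t0 m b hb hlb) as [B hB].
  assert (hA0 := Rle_trans _ _ _ (Rabs_pos _) (hA t0 (Rle_refl t0))).
  assert (hB0 := Rle_trans _ _ _ (Rabs_pos _) (hB t0 (Rle_refl t0))).
  exists (A + B). split; [lra|]. intros t x y ht hx hy.
  specialize (hA t ht). specialize (hB t ht).
  apply Rabs_le_between in hA. apply Rabs_le_between in hB.
  apply Rabs_le_between. lra.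
Qed.

(** Supplies the finite initial distance that uniqueness and the first step of
    the iteration start from: admissible pairs lie between functions with finite
    limits at infinity, hence bounded. *)
Lemma admissible_close (t0 M zeta : R) (alpha beta : R -> R) :
  0 < zeta ->
  continuous_on (halfline t0) alpha -> continuous_on (halfline t0) beta ->
  ex_int_from alpha t0 -> ex_int_from beta t0 ->
  is_lim alpha p_infty 0 -> is_lim beta p_infty 0 ->
  exists d, 0 <= d /\ forall p r, admissible t0 M alpha beta p ->
    admissible t0 M alpha beta r -> close t0 zeta d p r.
Proof.
  intros hz ha hb hai hbi hla hlb.
  assert (hM : forall g, continuous_on (halfline t0) g -> ex_int_from g t0 ->
            continuous_on (halfline t0) (fun t => M - int_from g t) /\
            is_lim (fun t => M - int_from g t) p_infty (M - 0)).
  { intros g hg hgi. split.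
    - apply D_in_continuous_on with (fun t => 0 - - g t). intros t ht.
      apply Dminus; [apply Dconst|now apply D_in_int_from].
    - apply is_lim_minus'; [apply is_lim_const|now apply is_lim_int_from_0 with t0]. }
  destruct (hM alpha ha hai) as [hMa hMla]. destruct (hM beta hb hbi) as [hMb hMlb].
  destruct (bounded_between t0 _ _ _ _ hMb hMa hMlb hMla) as [B1 [hB1 h1]].
  destruct (bounded_between t0 _ _ _ _ ha hb hla hlb) as [B2 [hB2 h2]].
  assert (hzB := Rmult_le_pos _ _ (Rlt_le _ _ hz) hB2).
  exists (B1 + zeta * B2). split; [lra|].
  intros p r [[_ hpu] [_ hpv]] [[_ hru] [_ hrv]] t ht. split.
  - apply Rle_trans with B1; [|lra]. apply h1 with t; auto.
  - apply Rle_trans with (zeta * B2); [|lra].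
    apply Rmult_le_compat_l; [lra|]. apply h2 with t; auto.
Qed.

(** The boundary data at infinity are M for y and, squeezed by alpha and beta,
    0 for its derivative; the fundamental theorem on [[t, +oo)] turns both
    derivatives into tail integrals. *)
Lemma solution_fixed_point (t0 M : R) (alpha beta : R -> R) (f : R -> R -> R -> R)
    (y dy ddy : R -> R) :
  continuous_on (halfline t0) alpha -> continuous_on (halfline t0) beta ->
  ex_int_from alpha t0 -> ex_int_from beta t0 ->
  is_lim alpha p_infty 0 -> is_lim beta p_infty 0 ->
  continuous_nonlinearity t0 f ->
  C2_with_derivatives t0 y dy ddy ->
  (forall t, t0 <= t -> ddy t + f t (y t) (dy t) = 0) ->
  is_lim y p_infty M -> (forall t, t0 <= t -> alpha t <= dy t <= beta t) ->
  admissible t0 M alpha beta (y, dy) /\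
  forall t, t0 <= t -> y t = fst (picard M f (y, dy)) t /\ dy t = snd (picard M f (y, dy)) t.
Proof.
  intros ha hb hai hbi hla hlb hf [hy [hdy hddy]] heq hlim hbd.
  assert (hyc := D_in_continuous_on _ _ _ hy).
  assert (hdyc := D_in_continuous_on _ _ _ hdy).
  assert (hD : in_D t0 alpha beta dy) by now split.
  assert (hy1 : forall t, t0 <= t -> y t = M - int_from dy t).
  { intros t ht. destruct (int_from_D_in t0 M y dy hy hdyc hlim t ht) as [_ ->]. ring. }
  assert (hdlim : is_lim dy p_infty 0).
  { apply is_lim_le_le_loc with alpha beta; auto.
    exists t0. intros s hs. apply hbd; lra. }
  assert (hdy1 : forall t, t0 <= t -> dy t = int_from (fun s => f s (y s) (dy s)) t).
  { intros t ht.
    destruct (int_from_D_in t0 0 dy ddy hdy hddy hdlim t ht) as [h1 h2].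
    destruct (int_from_scal t (-1) ddy h1) as [h3 h4].
    destruct (int_from_ext t (fun s => -1 * ddy s)
                (fun s => f s (y s) (dy s))) as [_ h5]; [|assumption|].
    - intros s hs. specialize (heq s ltac:(lra)). lra.
    - rewrite <- h5, h4, h2. ring. }
  split.
  - split; [|assumption]. simpl.
    destruct (in_C_antiderivative t0 M alpha beta dy ha hb hai hbi hD) as [_ h].
    split; [assumption|]. intros t ht. rewrite hy1 by assumption. now apply h.
  - intros t ht. simpl. split; [|now apply hdy1].
    rewrite hy1 by assumption. f_equal.
    apply (int_from_ext t dy).
    + intros s hs. apply hdy1; lra.
    + apply int_from_Chasles with t0; auto. now apply in_D_ex_int_from with alpha beta.
Qed.

(** The image of p is used rather than p: it is twice differentiable by construction, being
    made of tail integrals, while fixedness only matters pointwise, to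
    replace p by its image inside f. *)
Lemma fixed_point_solution (t0 M : R) (alpha beta : R -> R) (f : R -> R -> R -> R)
    (p : (R -> R) * (R -> R)) :
  continuous_on (halfline t0) alpha -> continuous_on (halfline t0) beta ->
  ex_int_from alpha t0 -> ex_int_from beta t0 ->
  continuous_nonlinearity t0 f ->
  ex_int_from (fun s => f s (fst p s) (snd p s)) t0 ->
  admissible t0 M alpha beta p -> admissible t0 M alpha beta (picard M f p) ->
  (forall t, t0 <= t -> fst p t = fst (picard M f p) t /\ snd p t = snd (picard M f p) t) ->
  is_solution t0 M alpha beta f (fst (picard M f p)).
Proof.
  intros ha hb hai hbi hf hF [[hu _] [hv _]] [_ hD] hfix.
  assert (hFc := continuous_on_nonlinearity t0 f (fst p) (snd p) hf hu hv).
  assert (hw := continuous_on_int_from _ _ hFc hF).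
  assert (hwi := in_D_ex_int_from _ _ _ _ ha hb hai hbi hD).
  exists (snd (picard M f p)), (fun s => - f s (fst p s) (snd p s)).
  split; [|split; [|split]].
  - split; [|split].
    + intros t ht. simpl.
      apply D_in_ext with (fun t => M - int_from (snd (picard M f p)) t)
        (fun t => 0 - - snd (picard M f p) t); auto.
      * simpl. ring.
      * apply Dminus; [apply Dconst|]. now apply D_in_int_from.
    + intros t ht. now apply D_in_int_from.
    + apply continuous_on_ext
        with (fun s => -1 * f s (fst p s) (snd p s) + 0 * f s (fst p s) (snd p s)).
      * intros s _. simpl. ring.
      * now apply continuous_on_lin.
  - intros t ht. destruct (hfix t ht) as [<- <-]. ring.
  - replace (Finite M) with (Finite (M - 0)) by (f_equal; ring).
    apply is_lim_minus'; [apply is_lim_const|]. now apply is_lim_int_from_0 with t0.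
  - apply hD.
Qed.

(** [iterated_tail_estimate] with the bounds d and d / zeta on the differences
    of first and second components; the ratio is then exactly the sum chi. *)
Lemma picard_contraction (t0 M zeta d : R) (alpha beta : R -> R) (f : R -> R -> R -> R)
    (k1 k2 : R -> R) (p r : (R -> R) * (R -> R)) :
  0 < zeta -> 0 <= d ->
  continuous_on (halfline t0) alpha -> continuous_on (halfline t0) beta ->
  ex_int_from alpha t0 -> ex_int_from beta t0 ->
  continuous_on (halfline t0) k1 -> continuous_on (halfline t0) k2 ->
  (forall t, t0 <= t -> 0 <= k1 t) -> (forall t, t0 <= t -> 0 <= k2 t) ->
  ex_int_from k1 t0 -> ex_int_from (fun t => (t - t0) * k1 t) t0 ->
  ex_int_from k2 t0 -> ex_int_from (fun t => (t - t0) * k2 t) t0 ->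
  continuous_nonlinearity t0 f ->
  (forall t, t0 <= t ->
    Rabs (f t (fst p t) (snd p t) - f t (fst r t) (snd r t))
    <= k1 t * Rabs (fst p t - fst r t) + k2 t * Rabs (snd p t - snd r t)) ->
  ex_int_from (fun s => f s (fst p s) (snd p s)) t0 ->
  ex_int_from (fun s => f s (fst r s) (snd r s)) t0 ->
  admissible t0 M alpha beta p -> admissible t0 M alpha beta r ->
  in_D t0 alpha beta (snd (picard M f p)) -> in_D t0 alpha beta (snd (picard M f r)) ->
  close t0 zeta d p r ->
  close t0 zeta (chi t0 k1 k2 zeta * d) (picard M f p) (picard M f r).
Proof.
  intros hz hd ha hb hai hbi hk1 hk2 hp1 hp2 hi1 hm1 hi2 hm2 hf hlip hFp hFr
    [[hpu _] [hpv _]] [[hru _] [hrv _]] hSp hSr hclose t ht.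
  assert (hzd : 0 <= d / zeta) by (apply Rdiv_le_0_compat; lra).
  destruct (iterated_tail_estimate t0 d (d / zeta) k1 k2
    (fun s => f s (fst r s) (snd r s)) (fun s => f s (fst p s) (snd p s))) with (t := t)
    as [hV hU]; auto using continuous_on_nonlinearity.
  - exact (in_D_ex_int_from _ _ _ _ ha hb hai hbi hSr).
  - exact (in_D_ex_int_from _ _ _ _ ha hb hai hbi hSp).
  - intros s hs. apply Rle_trans with (1 := hlip s hs).
    destruct (hclose s hs) as [h1 h2].
    rewrite (Rmult_comm d), (Rmult_comm (d / zeta)).
    apply Rplus_le_compat; apply Rmult_le_compat_l; auto.
    apply Rmult_le_reg_l with zeta; [assumption|].
    replace (zeta * (d / zeta)) with d by (field; lra). assumption.
  - assert (h1 : 0 <= int_from k1 t0) by now apply int_from_nonneg.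
    assert (h2 : 0 <= int_from k2 t0) by now apply int_from_nonneg.
    assert (hmom : forall k, (forall s, t0 <= s -> 0 <= k s) -> ex_int_from (fun s => (s - t0) * k s) t0 ->
              0 <= int_from (fun s => (s - t0) * k s) t0).
    { intros k hk hki. apply int_from_nonneg; auto. intros s hs.
      apply Rmult_le_pos; [lra|auto]. }
    assert (h3 := hmom k1 hp1 hm1). assert (h4 := hmom k2 hp2 hm2).
    set (K1 := int_from k1 t0) in *. set (K2 := int_from k2 t0) in *.
    set (M1 := int_from (fun s => (s - t0) * k1 s) t0) in *.
    set (M2 := int_from (fun s => (s - t0) * k2 s) t0) in *.
    assert (hsplit : chi t0 k1 k2 zeta * d
              = zeta * (d * K1 + d / zeta * K2) + (d * M1 + d / zeta * M2)).
    { unfold chi. fold K1 K2 M1 M2. field. lra. }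
    rewrite hsplit.
    assert (0 <= zeta * (d * K1 + d / zeta * K2)).
    { apply Rmult_le_pos; [lra|]. apply Rplus_le_le_0_compat; now apply Rmult_le_pos. }
    assert (0 <= d * M1 + d / zeta * M2)
      by (apply Rplus_le_le_0_compat; now apply Rmult_le_pos).
    split.
    + apply Rle_trans with (d * M1 + d / zeta * M2); [|lra].
      apply Rle_trans with (2 := hU). apply Req_le. simpl.
      rewrite Rabs_minus_sym. f_equal. ring.
    + apply Rle_trans with (zeta * (d * K1 + d / zeta * K2)); [|lra].
      apply Rmult_le_compat_l; [lra|exact hV].
Qed.

Theorem theorem6 (t0 M : R) (alpha beta : R -> R) (f : R -> R -> R -> R)
    (k1 k2 : R -> R)
    (ht0 : 0 <= t0)
    (halpha_cont : continuous_on (halfline t0) alpha)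
    (hbeta_cont : continuous_on (halfline t0) beta)
    (halpha_int : abs_integrable t0 alpha)
    (hbeta_int : abs_integrable t0 beta)
    (hle : forall t, t0 <= t -> alpha t <= beta t)
    (halpha_lim : is_lim alpha p_infty 0)
    (hbeta_lim : is_lim beta p_infty 0)
    (hf_cont : continuous_nonlinearity t0 f)
    (hf_int : forall u v : R -> R,
        in_C t0 M alpha beta u -> in_D t0 alpha beta v ->
        forall t, t0 <= t ->
          ex_int_from (fun s => f s (u s) (v s)) t /\
          alpha t <= int_from (fun s => f s (u s) (v s)) t <= beta t)
    (hf_lip : forall u1 u2 v1 v2 : R -> R,
        in_C t0 M alpha beta u1 -> in_C t0 M alpha beta u2 ->
        in_D t0 alpha beta v1 -> in_D t0 alpha beta v2 ->
        forall t, t0 <= t ->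
          Rabs (f t (u2 t) (v2 t) - f t (u1 t) (v1 t))
          <= k1 t * Rabs (u2 t - u1 t) + k2 t * Rabs (v2 t - v1 t))
    (hk1_cont : continuous_on (halfline t0) k1)
    (hk2_cont : continuous_on (halfline t0) k2)
    (hk1_nonneg : forall t, t0 <= t -> 0 <= k1 t)
    (hk2_nonneg : forall t, t0 <= t -> 0 <= k2 t)
    (hk1_int : ex_int_from k1 t0)
    (hk1_mom : ex_int_from (fun t => (t - t0) * k1 t) t0)
    (hk2_int : ex_int_from k2 t0)
    (hk2_mom : ex_int_from (fun t => (t - t0) * k2 t) t0)
    (hchi : exists zeta : R, 0 < zeta /\ chi t0 k1 k2 zeta < 1) :
  exists x : R -> R,
    is_solution t0 M alpha beta f x /\
    forall y : R -> R, is_solution t0 M alpha beta f y ->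
      forall t, t0 <= t -> y t = x t.
Proof.
  destruct hchi as [zeta [hz hchi]].
  assert (hai := abs_integrable_ex_int_from _ _ halpha_cont halpha_int).
  assert (hbi := abs_integrable_ex_int_from _ _ hbeta_cont hbeta_int).
  set (P := admissible t0 M alpha beta).
  assert (hF : forall p, P p -> ex_int_from (fun s => f s (fst p s) (snd p s)) t0).
  { intros p [hu hv]. apply (hf_int _ _ hu hv). lra. }
  assert (hSD : forall p, P p -> in_D t0 alpha beta (snd (picard M f p))).
  { intros p hp. split.
    - apply continuous_on_int_from; [|now apply hF].
      destruct hp as [[hu _] [hv _]]. now apply continuous_on_nonlinearity.
    - intros t ht. destruct hp as [hu hv]. now apply (hf_int _ _ hu hv). }
  assert (hS : forall p, P p -> P (picard M f p)).
  { intros p hp. split; [|now apply hSD].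
    apply (in_C_antiderivative t0 M alpha beta (snd (picard M f p))); auto. }
  assert (hcontr : forall p r d, 0 <= d -> P p -> P r -> close t0 zeta d p r ->
            close t0 zeta (chi t0 k1 k2 zeta * d) (picard M f p) (picard M f r)).
  { intros p r d hd hp hr hpr.
    apply picard_contraction with alpha beta; auto.
    destruct hp as [hpu hpv], hr as [hru hrv]. now apply hf_lip. }
  assert (hq : 0 <= chi t0 k1 k2 zeta < 1).
  { split; [|assumption]. unfold chi.
    assert (hmom : forall k, (forall s, t0 <= s -> 0 <= k s) ->
              forall s, t0 <= s -> 0 <= (s - t0) * k s).
    { intros k hk s hs. apply Rmult_le_pos; [lra|auto]. }
    repeat apply Rplus_le_le_0_compat; try apply Rmult_le_pos;
      try (now apply int_from_nonneg; auto); try lra.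
    now apply Rlt_le, Rinv_0_lt_compat. }
  set (p0 := (fun t => M - int_from alpha t, alpha)).
  assert (hp0 : P p0).
  { assert (hD : in_D t0 alpha beta alpha).
    { split; [assumption|]. intros t ht. specialize (hle t ht). lra. }
    split; [now apply in_C_antiderivative|assumption]. }
  destruct (admissible_close t0 M zeta alpha beta) as [d [hd hbd]]; auto.
  destruct (contraction_fixed_point t0 zeta (chi t0 k1 k2 zeta) d P (picard M f) p0)
    as [p [hp hfix]]; auto.
  { now apply hbd; [|apply hS]. }
  { intros p. now apply admissible_closed. }
  exists (fst (picard M f p)). split.
  - apply fixed_point_solution; auto. now apply hS.
  - intros y [dy [ddy [hC2 [heq [hlim hbdy]]]]] t ht.
    destruct (solution_fixed_point t0 M alpha beta f y dy ddy) as [hPy hfy]; auto.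
    destruct (contraction_unique t0 zeta (chi t0 k1 k2 zeta) d P (picard M f) (y, dy) p)
      with (t := t) as [h _]; auto.
    destruct (hfix t ht) as [<- _]. exact h.
Qed.
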